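(* Let $\lambda=-u^2\in\mathbb C$ be a nonzero relation number, and let $k$ be the smallest positive integer such that $s^{\mathbf n}_{k+1}(u)=0$ for some nonzero integer sequence $\mathbf n=(n_1,\dots,n_k)$. Then there exist positive integers $N_1,N_2,\dots,N_k$ such that $|n'_i|\le N_i$ for all $i=1,\dots,k$ holds for every nonzero integer sequence $\mathbf n'=(n'_1,\dots,n'_k)$ with $s^{\mathbf n'}_{k+1}(u)=0$.
   Context: $\lambda\in\mathbb C$ is a relation number if the subgroup of $SL(2,\mathbb C)$ generated by $\begin{pmatrix}1&1\\0&1\end{pmatrix}$ and $\begin{pmatrix}1&0\\ \lambda&1\end{pmatrix}$ is not a free group of rank $2$. A nonzero integer sequence is a sequence all of whose entries are nonzero integers. For an integer sequence $\mathbf n=(n_1,n_2,\dots)$: $s^{\mathbf n}_0(t)=0$, $s^{\mathbf n}_1(t)=1$, $s^{\mathbf n}_{j+1}(t)=n_j\,t\,s^{\mathbf n}_j(t)-s^{\mathbf n}_{j-1}(t)$ (so $s^{\mathbf n}_{k+1}$ depends only on $n_1,\dots,n_k$). *)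

(* Defs.v *)
(* The complex numbers are [R[i]] for [R : realType]. *)
From HB Require Import structures.
From mathcomp Require Import all_boot all_order all_algebra.
From mathcomp Require Import complex.
From mathcomp Require Import reals.

Set Implicit Arguments.
Unset Strict Implicit.
Unset Printing Implicit Defensive.

Import GRing.Theory.

Section FreeGroups.
Local Open Scope group_scope.

Definition is_subgroup (G : groupType) (H : G -> Prop) : Prop :=
  [/\ H 1, forall x y, H x -> H y -> H (x * y) & forall x, H x -> H x^-1].

Definition subgroup_generated (G : groupType) (S : G -> Prop) (g : G) : Prop :=
  forall H : G -> Prop, is_subgroup H -> (forall x, S x -> H x) -> H g.

(* The letter [(i, b)] stands for the [i]-th generator if [b = false] and for
   its inverse if [b = true]. *)
Definition letter (r : nat) : Type := ('I_r * bool)%type.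

Definition letter_inv (r : nat) (l : letter r) : letter r := (l.1, ~~ l.2).

Definition reduced (r : nat) (w : seq (letter r)) : bool :=
  sorted (fun a b : letter r => b != letter_inv a) w.

Definition eval_letter (G : groupType) (r : nat) (x : 'I_r -> G)
    (l : letter r) : G :=
  if l.2 then (x l.1)^-1 else x l.1.

Definition eval_word (G : groupType) (r : nat) (x : 'I_r -> G)
    (w : seq (letter r)) : G :=
  \prod_(l <- w) eval_letter x l.

(* [H] is meant to be a subgroup.  The elements of the free group on [r]
   letters are the reduced words, so this says that evaluation at some
   [x_0, .., x_(r-1)] in [H] is an isomorphism from that free group onto [H];
   the [x_i] are an arbitrary family, not a prescribed generating set. *)
Definition is_free_of_rank (G : groupType) (r : nat) (H : G -> Prop) : Prop :=
  exists x : 'I_r -> G,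
    (forall i, H (x i)) /\
    (forall h, H h -> exists! w, reduced w /\ eval_word x w = h).

End FreeGroups.

Local Open Scope ring_scope.

Section SpecialLinear.
Variable K : fieldType.

Record SL2 : Type := MkSL2 { SL2val :> 'M[K]_2; _ : \det SL2val == 1 }.

HB.instance Definition _ := [isSub for SL2val].
HB.instance Definition _ := [Choice of SL2 by <:].

Fact SL2_det (A : SL2) : \det (A : 'M[K]_2) = 1.
Proof. by apply/eqP; case: A. Qed.

Fact SL2_unit (A : SL2) : (A : 'M[K]_2) \in unitmx.
Proof. by rewrite unitmxE SL2_det unitr1. Qed.

Fact SL2_one_subproof : \det (1%:M : 'M[K]_2) == 1.
Proof. by rewrite det1. Qed.

Fact SL2_mul_subproof (A B : SL2) : \det ((A : 'M[K]_2) *m B) == 1.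
Proof. by rewrite det_mulmx !SL2_det mulr1. Qed.

Fact SL2_inv_subproof (A : SL2) : \det (invmx (A : 'M[K]_2)) == 1.
Proof. by rewrite det_inv SL2_det invr1. Qed.

Definition SL2_one : SL2 := MkSL2 SL2_one_subproof.
Definition SL2_mul (A B : SL2) : SL2 := MkSL2 (SL2_mul_subproof A B).
Definition SL2_inv (A : SL2) : SL2 := MkSL2 (SL2_inv_subproof A).

Fact SL2_mulA : associative SL2_mul.
Proof. by move=> A B C; apply: val_inj; rewrite /= mulmxA. Qed.

Fact SL2_1mul : left_id SL2_one SL2_mul.
Proof. by move=> A; apply: val_inj; rewrite /= mul1mx. Qed.

Fact SL2_mul1 : right_id SL2_one SL2_mul.
Proof. by move=> A; apply: val_inj; rewrite /= mulmx1. Qed.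

Fact SL2_Vmul : left_inverse SL2_one SL2_inv SL2_mul.
Proof. by move=> A; apply: val_inj; rewrite /= mulVmx ?SL2_unit. Qed.

Fact SL2_mulV : right_inverse SL2_one SL2_inv SL2_mul.
Proof. by move=> A; apply: val_inj; rewrite /= mulmxV ?SL2_unit. Qed.

HB.instance Definition _ :=
  isGroup.Build SL2 SL2_mulA SL2_1mul SL2_mul1 SL2_Vmul SL2_mulV.

Definition mx22 (a b c d : K) : 'M[K]_2 :=
  \matrix_(i < 2, j < 2)
    if i == 0 then (if j == 0 then a else b) else (if j == 0 then c else d).

Fact mx22_det (a b c d : K) : \det (mx22 a b c d) = a * d - b * c.
Proof.
rewrite (expand_det_row _ ord0) !big_ord_recl big_ord0 /cofactor !det_mx11.
by rewrite !mxE /= expr0 expr1 mul1r mulN1r mulrN addr0.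
Qed.

Fact upper_subproof (a : K) : \det (mx22 1 a 0 1) == 1.
Proof. by rewrite mx22_det mulr0 mulr1 subr0. Qed.

Fact lower_subproof (a : K) : \det (mx22 1 0 a 1) == 1.
Proof. by rewrite mx22_det mul0r mulr1 subr0. Qed.

Definition upper (a : K) : SL2 := MkSL2 (upper_subproof a).
Definition lower (a : K) : SL2 := MkSL2 (lower_subproof a).

End SpecialLinear.

Definition relation_number (R : realType) (lambda : R[i]) : Prop :=
  ~ is_free_of_rank 2
      (subgroup_generated
         (fun g : SL2 R[i] => g = upper 1 \/ g = lower lambda)).

(* Sequences are indexed from 0: [n j] is the entry n_(j+1), so the recurrence
   reads s_(j+1) = n_j t s_j - s_(j-1) for j >= 1. *)
Fixpoint s_poly (K : pzRingType) (n : nat -> int) (t : K) (j : nat) : K :=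
  match j with
  | 0 => 0
  | j'.+1 =>
      match j' with
      | 0 => 1
      | j''.+1 => (n j'')%:~R * t * s_poly n t j' - s_poly n t j''
      end
  end.

Definition nonzero_seq (k : nat) (n : k.-tuple int) : Prop :=
  forall i : 'I_k, tnth n i != 0.

(* s_(k+1) for a finite sequence n_1, .., n_k; the entries beyond n_k, set here
   to 0, do not enter the recurrence up to index k + 1. *)
Definition s_last (K : pzRingType) (k : nat) (n : k.-tuple int) (t : K) : K :=
  s_poly (fun j => n`_j) t k.+1.

Definition has_zero_seq (K : pzRingType) (u : K) (k : nat) : Prop :=
  exists n : k.-tuple int, nonzero_seq n /\ s_last n u = 0.

Definition is_smallest_positive (P : nat -> Prop) (k : nat) : Prop :=
  [/\ (0 < k)%N, P k & forall m, (0 < m)%N -> P m -> (k <= m)%N].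

(* Main.v *)
(* s_(k+1) is a continuant in n_1 t, .., n_k t.  Splitting it at an entry n_i
   gives s = n_i t A B - A B' - A' B, where A and B are the continuants of the
   entries before and after n_i, and A', B' are A, B with the entry next to n_i
   dropped.  Since no shorter continuant vanishes, induction on m < k gives
   prod |n_l| <= D |s_(m+1)| uniformly in n: if some entry is large, the term
   n_i t A B dominates, and otherwise only finitely many n remain.  The same
   estimate at length k shows that s_(k+1) <> 0 as soon as one entry is large. *)
Require Import Defs.
From mathcomp Require Import all_boot all_order all_algebra.
From mathcomp Require Import complex.
From mathcomp Require Import reals.
From mathcomp Require Import zify ring.

Import Order.TTheory GRing.Theory Num.Theory.
Local Open Scope ring_scope.

(** * Continuant identities *)

Definition shift (i : nat) (n : nat -> int) : nat -> int := fun l => n (i + l)%N.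

Lemma s_polySS (K : pzRingType) (n : nat -> int) (t : K) j :
  s_poly n t j.+2 = (n j)%:~R * t * s_poly n t j.+1 - s_poly n t j.
Proof. by []. Qed.

Lemma eq_s_poly (K : pzRingType) (t : K) (n n' : nat -> int) m :
  (forall l, (l < m)%N -> n l = n' l) -> s_poly n t m.+1 = s_poly n' t m.+1.
Proof.
move=> eq_n; suff: forall j, (j <= m)%N ->
  s_poly n t j = s_poly n' t j /\ s_poly n t j.+1 = s_poly n' t j.+1.
  by move=> /(_ m (leqnn m)) [].
elim=> [//|j IH] lt_jm; have [eq0 eq1] := IH (ltnW lt_jm).
by split=> //; rewrite !s_polySS eq0 eq1 eq_n.
Qed.

(** Euler's identity for continuants. The recurrence has order two, so the induction on [j] carries
    two consecutive indices. *)
Lemma s_poly_add (K : comPzRingType) (t : K) (n : nat -> int) i j :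
  s_poly n t (i + j).+1 =
    s_poly n t i.+1 * s_poly (shift i n) t j.+1
    - s_poly n t i * s_poly (shift i.+1 n) t j.
Proof.
suff [] : s_poly n t (i + j).+1 =
    s_poly n t i.+1 * s_poly (shift i n) t j.+1
    - s_poly n t i * s_poly (shift i.+1 n) t j
  /\ s_poly n t (i + j.+1).+1 =
    s_poly n t i.+1 * s_poly (shift i n) t j.+2
    - s_poly n t i * s_poly (shift i.+1 n) t j.+1 by [].
elim: j => [|j [IH0 IH1]].
  by rewrite addn0 addn1 !s_polySS /shift addn0 /=; split; ring.
split=> //; rewrite !addnS in IH1 *.
rewrite (s_polySS _ n t (i + j).+1) IH1 IH0.
rewrite (s_polySS _ (shift i n) t j.+1) (s_polySS _ (shift i.+1 n) t j).
by rewrite /shift addSnnS !addnS; ring.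
Qed.

(** Euler's identity used twice, cutting just before and just after [n i]. If nothing follows [n i],
    then [m = 0] and the factor B' is s_0 = 0. *)
Lemma s_poly_split (K : comPzRingType) (t : K) (n : nat -> int) i m :
  s_poly n t (i + m.+1).+1 =
    (n i)%:~R * t * s_poly n t i.+1 * s_poly (shift i.+1 n) t m.+1
    - s_poly n t i.+1 * s_poly (shift 1 (shift i.+1 n)) t m
    - s_poly n t i * s_poly (shift i.+1 n) t m.+1.
Proof.
rewrite s_poly_add -[m.+1]add1n (s_poly_add _ t (shift i n) 1 m) add1n.
have -> : s_poly (shift 1 (shift i n)) t m.+1 = s_poly (shift i.+1 n) t m.+1.
  by apply: eq_s_poly => l _; rewrite /shift addnA addn1.
have -> : s_poly (shift 2 (shift i n)) t m = s_poly (shift 1 (shift i.+1 n)) t m.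
  (* [eq_s_poly] concerns successor indices; for [m = 0] both sides are s_0 = 0. *)
  case: m => [//|m]; apply: eq_s_poly => l _.
  by rewrite /shift !addnA addn2 addn1.
by rewrite s_polySS /shift addn0 /=; ring.
Qed.

(** * Upper bounds for continuants by the product of the entries *)

Section Growth.
Variables (K : numFieldType) (t : K).
Implicit Types n : nat -> int.

Definition entry_prod n m : K := \prod_(l < m) `|(n l)%:~R|.

Lemma entry_ge1 (x : int) : x != 0 -> 1 <= `|x%:~R| :> K.
Proof. by move=> x0; rewrite -intr_norm ler1z -gtz0_ge1 normr_gt0. Qed.

Lemma entry_prod_ge0 n m : 0 <= entry_prod n m.
Proof. by apply: prodr_ge0. Qed.

Lemma entry_prodS n m : entry_prod n m.+1 = entry_prod n m * `|(n m)%:~R|.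
Proof. by rewrite /entry_prod big_ord_recr. Qed.

Lemma entry_prodSl n m :
  entry_prod n m.+1 = `|(n 0%N)%:~R| * entry_prod (shift 1 n) m.
Proof. by rewrite /entry_prod big_ord_recl. Qed.

Lemma entry_prod_split n i m :
  entry_prod n (i + m.+1) =
    entry_prod n i * `|(n i)%:~R| * entry_prod (shift i.+1 n) m.
Proof.
elim: m => [|m IH]; first by rewrite addn1 entry_prodS /entry_prod big_ord0 mulr1.
by rewrite addnS entry_prodS IH entry_prodS /shift addSnnS !mulrA.
Qed.

Section NonzeroEntries.
Variable n : nat -> int.
Hypothesis n_neq0 : forall l, n l != 0.

Lemma entry_prod_ge1 m : 1 <= entry_prod n m.
Proof.
elim: m => [|m IH]; first by rewrite /entry_prod big_ord0.
by rewrite entry_prodS mulr_ege1 ?entry_ge1.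
Qed.

Lemma entry_prod_leS m : entry_prod n m <= entry_prod n m.+1.
Proof. by rewrite entry_prodS ler_peMr ?entry_prod_ge0 ?entry_ge1. Qed.

(** Since |n_j| >= 1, a step of the recurrence costs at most the factor |n_j| |t| + 1 <= |n_j| (|t|
    + 1). *)
Lemma s_poly_le m : `|s_poly n t m.+1| <= (`|t| + 1) ^+ m * entry_prod n m.
Proof.
suff [] : `|s_poly n t m.+1| <= (`|t| + 1) ^+ m * entry_prod n m /\
  `|s_poly n t m.+2| <= (`|t| + 1) ^+ m.+1 * entry_prod n m.+1 by [].
have t0 : 0 <= `|t| + 1 by rewrite addr_ge0.
elim: m => [|m [IH0 IH1]].
  rewrite entry_prodS /entry_prod big_ord0 /= !expr0 expr1 !mul1r mulr1 subr0.
  by rewrite normr1 normrM mulrC ler_wpM2r // lerDl ler01.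
split=> //; rewrite s_polySS (le_trans (ler_normB _ _)) // !normrM.
have p0 := entry_prod_ge0 n m.
have C0 : 0 <= (`|t| + 1) ^+ m by rewrite exprn_ge0.
apply: (@le_trans _ _ (`|(n m.+1)%:~R| * `|t| *
   ((`|t| + 1) ^+ m.+1 * entry_prod n m.+1) +
   (`|t| + 1) ^+ m.+1 * entry_prod n m.+2)); last first.
  by rewrite (entry_prodS n m.+1) (exprS _ m.+1) le_eqVlt; apply/predU1P; left; ring.
apply: lerD; first by rewrite ler_wpM2l // mulr_ge0.
apply: (le_trans IH0); apply: ler_pM => //.
  by rewrite exprS ler_peMl // lerDr.
exact: le_trans (entry_prod_leS m) (entry_prod_leS m.+1).
Qed.

End NonzeroEntries.

(** Serves for A', which omits the last entry of A: the product over all of A is what the lower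
    bound for |A| controls. *)
Lemma s_poly_leS n m : (forall l, n l != 0) ->
  `|s_poly n t m| <= (`|t| + 1) ^+ m * entry_prod n m.
Proof.
move=> n0; have t0 : 0 <= `|t| + 1 by rewrite addr_ge0.
case: m => [|m]; first by rewrite /= normr0 mulr_ge0 ?exprn_ge0 ?entry_prod_ge0.
apply: le_trans (s_poly_le n n0 m) _; apply: ler_pM.
- exact: exprn_ge0.
- exact: entry_prod_ge0.
- by rewrite exprS ler_peMl ?exprn_ge0 // lerDr.
- exact: entry_prod_leS.
Qed.

(** The counterpart for B', which omits the first entry of B. *)
Lemma s_poly_shift_le n m : (forall l, n l != 0) ->
  `|s_poly (shift 1 n) t m| <= (`|t| + 1) ^+ m * entry_prod n m.
Proof.
move=> n0; have t0 : 0 <= `|t| + 1 by rewrite addr_ge0.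
have n0' l : shift 1 n l != 0 by exact: n0.
case: m => [|m]; first by rewrite /= normr0 mulr_ge0 ?exprn_ge0 ?entry_prod_ge0.
apply: le_trans (s_poly_le _ n0' m) _; apply: ler_pM.
- exact: exprn_ge0.
- exact: entry_prod_ge0.
- by rewrite exprS ler_peMl ?exprn_ge0 // lerDr.
- by rewrite entry_prodSl ler_peMl ?entry_prod_ge0 // entry_ge1.
Qed.

(** * Lower bounds uniform in the sequence *)

Definition uniformly_large (D : K) (k : nat) : Prop :=
  forall n m, (forall l, n l != 0) -> (m < k)%N ->
    entry_prod n m <= D * `|s_poly n t m.+1|.

(* A hypothesis because [R[i]] has no canonical [archiNumFieldType] structure. *)
Hypothesis archiK : forall x : K, exists N : nat, `|x| <= N%:R.
Hypothesis t_neq0 : t != 0.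

(** Both pieces around [n i] are shorter than [m], so bounds for lengths below [k] reach length [k]
    itself. They give |A'| <= F |A| and |B'| <= F |B|, and a large [n i] makes the main term
    dominate. *)
Lemma large_entry (D : K) k : 0 <= D -> uniformly_large D k ->
  exists B : nat, exists2 E : K, 0 <= E &
    forall n m i, (forall l, n l != 0) -> (m <= k)%N -> (i < m)%N ->
      (B < `|n i|)%N -> entry_prod n m <= E * `|s_poly n t m.+1|.
Proof.
move=> D0 ulD; pose C : K := `|t| + 1; pose F : K := C ^+ k * D.
have C1 : 1 <= C by rewrite lerDr.
have C0 : 0 <= C := le_trans ler01 C1.
have F0 : 0 <= F by rewrite mulr_ge0 ?exprn_ge0.
have t_gt0 : 0 < `|t| by rewrite normr_gt0.
(* Beyond this threshold |n_i t| >= 4F, so the error 2F |A| |B| is at most half of the main term. *)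
have [B leB] := archiK (4 * F / `|t|).
exists B; exists (2 * D ^+ 2 / `|t|); first by rewrite divr_ge0 ?mulr_ge0 ?exprn_ge0.
move=> n m i n0 lemk lti ltB.
have [j eq_m] : exists j, m = (i + j.+1)%N.
  by exists (m - i.+1)%N; rewrite addnS -addSn subnKC.
subst m; have lt_ik : (i < k)%N by apply: leq_trans lemk; rewrite addnS ltnS leq_addr.
have lt_jk : (j < k)%N by apply: leq_trans lemk; rewrite leq_addl.
have n0' l : shift i.+1 n l != 0 by exact: n0.
have CF (p : K) q (e : K) : (q < k)%N -> 0 <= p -> p <= D * e -> C ^+ q * p <= F * e.
  move=> lt_qk p0 le_p; rewrite /F -mulrA; apply: ler_pM => //.
    exact: exprn_ge0.
  by apply: ler_weXn2l => //; exact: ltnW.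
have lea := ulD n i n0 lt_ik; have leb := ulD _ j n0' lt_jk.
have lea' := le_trans (s_poly_leS n i n0) (CF _ _ _ lt_ik (entry_prod_ge0 _ _) lea).
have leb' := le_trans (s_poly_shift_le _ j n0') (CF _ _ _ lt_jk (entry_prod_ge0 _ _) leb).
have := s_poly_split _ t n i j; rewrite entry_prod_split.
move: (s_poly n t i.+1) (s_poly (shift i.+1 n) t j.+1) (s_poly n t i)
  (s_poly (shift 1 (shift i.+1 n)) t j) lea leb lea' leb'
  (s_poly n t (i + j.+1).+1) => a b a' b' lea leb lea' leb' s eq_s.
set X : K := `|(n i)%:~R|; have X0 : 0 <= X by exact: normr_ge0.
have leX : 4 * F <= X * `|t|.
  have F4 : 0 <= 4 * F / `|t| by rewrite divr_ge0 // mulr_ge0 ?ler0n.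
  rewrite -ler_pdivrMr //; move: leB; rewrite ger0_norm // => /le_trans; apply.
  by rewrite /X -intr_norm -abszE -natz mulrz_nat ler_nat ltnW.
have ab0 : 0 <= `|a| * `|b| by rewrite mulr_ge0.
have le_s : X * `|t| * (`|a| * `|b|) <= 2 * `|s|.
  have : X * `|t| * (`|a| * `|b|) <= `|s| + 2 * F * (`|a| * `|b|).
    have -> : X * `|t| * (`|a| * `|b|) = `|s + a * b' + a' * b|.
      by rewrite /X -!normrM; congr `|_|; rewrite eq_s; ring.
    apply: le_trans (ler_normD _ _) _.
    apply: le_trans (lerD (ler_normD _ _) (lexx _)) _.
    rewrite -addrA lerD2l !normrM.
    have -> : 2 * F * (`|a| * `|b|) = `|a| * (F * `|b|) + F * `|a| * `|b| by ring.
    by apply: lerD; [rewrite ler_wpM2l | rewrite ler_wpM2r].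
  (* Doubling Y <= |s| + 2F |A| |B| and using 4F |A| |B| <= Y leaves Y <= 2 |s|. *)
  have := ler_wpM2r ab0 leX; move: (X * `|t| * _) => Y le4 le1.
  rewrite -(lerD2r Y); apply: (le_trans (lerD le1 le1)).
  have -> : `|s| + 2 * F * (`|a| * `|b|) + (`|s| + 2 * F * (`|a| * `|b|)) =
    2 * `|s| + 4 * F * (`|a| * `|b|) by ring.
  by rewrite lerD2l.
apply: (@le_trans _ _ (D * `|a| * X * (D * `|b|))).
  by apply: ler_pM; rewrite ?mulr_ge0 ?entry_prod_ge0 // ler_wpM2r.
have -> : D * `|a| * X * (D * `|b|) = D ^+ 2 / `|t| * (X * `|t| * (`|a| * `|b|)).
  by field; rewrite lt0r_neq0.
have -> : 2 * D ^+ 2 / `|t| * `|s| = D ^+ 2 / `|t| * (2 * `|s|) by ring.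
by rewrite ler_wpM2l // divr_ge0 ?exprn_ge0.
Qed.

(** Such an [f] takes finitely many values on the box, and the sum of their absolute values bounds
    each. An entry in [-B, B] is coded by adding B, as an ordinal below 2B + 1. *)
Lemma box_bound (f : (nat -> int) -> K) m B :
  (forall n n', (forall l, (l < m)%N -> n l = n' l) -> f n = f n') ->
  exists2 D : K, 0 <= D &
    forall n, (forall l, (l < m)%N -> (`|n l| <= B)%N) -> `|f n| <= D.
Proof.
move=> eqf; pose d (x : m.-tuple 'I_(B.*2.+1)) : nat -> int :=
  fun l => (nth 0%N (map val x) l)%:Z - B%:Z.
exists (\sum_x `|f (d x)|); first exact: sumr_ge0.
move=> n leB; pose x := [tuple (inord (absz (n i + B%:Z)) : 'I_(B.*2.+1)) | i < m].
have -> : f n = f (d x).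
  apply: eqf => l lt_lm; rewrite /d (nth_map ord0) ?size_tuple //.
  rewrite -[l]/(val (Ordinal lt_lm)) -tnth_nth tnth_mktuple /=.
  have := leB _ lt_lm => le_lB; rewrite inordK; lia.
by rewrite (bigD1 x) //= lerDl sumr_ge0.
Qed.

Lemma uniformly_largeS (D : K) k : 0 <= D -> uniformly_large D k ->
  (forall n, (forall l, n l != 0) -> s_poly n t k.+1 != 0) ->
  exists2 D', 0 <= D' & uniformly_large D' k.+1.
Proof.
move=> D0 ulD nz; have [B [E E0 leE]] := large_entry D k D0 ulD.
(* When all entries are small, the quotient to be bounded has only finitely many values. *)
have [|G G0 leG] := box_bound (fun n => entry_prod n k / s_poly n t k.+1) k B.
  move=> n n' eqn; rewrite (eq_s_poly _ _ _ _ _ eqn); congr (_ / _).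
  by apply: eq_bigr => l _; rewrite eqn.
(* The sum dominates the constants of the three cases: shorter length, large entry, small
   entries. *)
exists (D + E + G); first by rewrite !addr_ge0.
move=> n m n0; have s0 := normr_ge0 (s_poly n t m.+1).
rewrite ltnS leq_eqVlt => /orP[/eqP eq_mk|lt_mk]; last first.
  by apply: le_trans (ulD _ _ n0 lt_mk) _; rewrite ler_wpM2r // -addrA lerDl addr_ge0.
subst m.
have [/forallP small|/forallPn [l]] := boolP [forall i : 'I_k, (`|n i| <= B)%N].
  have /leG : forall l, (l < k)%N -> (`|n l| <= B)%N.
    by move=> l lt_lk; exact: (small (Ordinal lt_lk)).
  rewrite normf_div ger0_norm ?entry_prod_ge0 // ler_pdivrMr ?normr_gt0 ?nz //.
  by move=> le1; apply: le_trans le1 _; rewrite ler_wpM2r // lerDr addr_ge0.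
rewrite -ltnNge => ltB.
apply: le_trans (leE _ _ _ n0 (leqnn k) (ltn_ord l) ltB) _.
by rewrite ler_wpM2r // addrAC lerDr addr_ge0.
Qed.

Lemma zero_entries_bounded k :
  (forall m n, (m < k)%N -> (forall l, n l != 0) -> s_poly n t m.+1 != 0) ->
  exists B : nat, forall n, (forall l, n l != 0) -> s_poly n t k.+1 = 0 ->
    forall i, (i < k)%N -> (`|n i| <= B)%N.
Proof.
move=> nz.
have [D D0 ulD] : exists2 D, 0 <= D & uniformly_large D k.
  (* No length lies below 0, so the induction can start from the constant 0. *)
  elim: k nz => [|k IH] nz; first by exists 0.
  have [|D D0 ulD] := IH; first by move=> m n lt_mk; apply: nz; exact: ltnW.
  by apply: (uniformly_largeS D k) => // n; exact: nz.
have [B [E E0 leE]] := large_entry D k D0 ulD.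
exists B => n n0 s0 i lt_ik; rewrite leqNgt; apply/negP => ltB.
(* With s = 0 the estimate makes a product that is at least 1 nonpositive. *)
have := leE n k i n0 (leqnn k) lt_ik ltB; rewrite s0 normr0 mulr0.
by move/(le_trans (entry_prod_ge1 n n0 k)); rewrite ler10.
Qed.

End Growth.

(** * Application to the complex numbers *)

Lemma complex_archi (R : realType) (x : R[i]) : exists N : nat, `|x| <= N%:R.
Proof.
rewrite normc_def; set r : R := Num.sqrt _.
exists (Num.bound r); rewrite -(rmorph_nat (@real_complex R)) lecR.
by rewrite ltW // archi_boundP // sqrtr_ge0.
Qed.

Theorem theoremB (R : realType) (lambda u : R[i]) (k : nat) :
  lambda = - u ^+ 2 ->
  lambda != 0 ->
  relation_number lambda ->
  is_smallest_positive (has_zero_seq u) k ->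
  exists N : k.-tuple nat,
    (forall i : 'I_k, (0 < tnth N i)%N) /\
    (forall n' : k.-tuple int,
       nonzero_seq n' -> s_last n' u = 0 ->
       forall i : 'I_k, `|tnth n' i| <= (tnth N i)%:Z).
Proof.
move=> -> lambda0 _ [_ _ min_k].
have u0 : u != 0 by apply: contraNneq lambda0 => ->; rewrite expr0n oppr0.
have [|B leB] := zero_entries_bounded _ u (complex_archi R) u0 k.
  move=> m n lt_mk n0; apply/eqP => s0.
  (* Since s_1 = 1, a vanishing continuant has positive length. *)
  have m0 : (0 < m)%N by case: (m) s0 => // /eqP; rewrite oner_eq0.
  suff /(min_k _ m0) : has_zero_seq u m by rewrite leqNgt lt_mk.
  exists [tuple n i | i < m]; split=> [i|]; first by rewrite tnth_mktuple.
  rewrite -s0; apply: eq_s_poly => l lt_lm.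
  by rewrite -[l]/(val (Ordinal lt_lm)) -tnth_nth tnth_mktuple.
(* [B] may be 0, hence the successor. *)
exists [tuple B.+1 | _ < k]; split=> [i|n' n0 s0 i]; rewrite tnth_mktuple //.
(* Padding by 1 instead of 0 keeps every entry nonzero and leaves s_(k+1) unchanged. *)
pose n l := nth 1 n' l.
have nE j : n (val j) = tnth n' j by rewrite (tnth_nth 1).
suff : (`|n i| <= B)%N by rewrite nE; lia.
apply: leB => //.
  move=> l; have [lt_lk|le_kl] := ltnP l k; last by rewrite /n nth_default ?size_tuple.
  by rewrite (nE (Ordinal lt_lk)).
by rewrite -s0; apply: eq_s_poly => l lt_lk; apply: set_nth_default; rewrite size_tuple.
Qed.
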